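(* In weak order $\leq$, $W$ is a complete meet semilattice. The join (when existing) and meet of a non-empty subset $X$ of $W$ are given as follows: (a) The join $y:=\bigvee X$ exists in $(W,\leq)$ if and only if $X$ has an upper bound in $W$, in which case $\Phi_{y}=\overline{\bigcup_{x\in X}\Phi_{x}}$. (b) If $y:=\bigwedge X$, then $\Phi'_{y}=\overline{\bigcup_{x\in X}\Phi'_{x}}$.
   Context: Setting: $V$ is a real vector space with a symmetric bilinear form $\langle\cdot,\cdot\rangle$ and $\Pi\subseteq V$ is a set (the simple roots, possibly infinite) such that (i) $\Pi$ is positively independent (if a finite sum $\sum_{\alpha\in\Pi}c_\alpha\alpha=0$ with all $c_\alpha\geq 0$, then all $c_\alpha=0$); (ii) $\langle\alpha,\alpha\rangle=1$ for $\alpha\in\Pi$, and $\langle\alpha,\beta\rangle\in\{-\cos(\pi/m)\mid m\in\mathbb{Z}_{\geq 2}\}\cup(-\infty,-1]$ for distinct $\alpha,\beta\in\Pi$. For $\alpha\in V$ with $\langle\alpha,\alpha\rangle=1$, let $s_\alpha(v)=v-2\langle v,\alpha\rangle\alpha$. Then $S=\{s_\alpha\mid\alpha\in\Pi\}$, $W=\langle S\rangle$ is a Coxeter group with Coxeter system $(W,S)$ and length function $l$. The root system is $\Phi=W\Pi$; the positive roots $\Phi_+$ are the roots that are non-negative real linear combinations of $\Pi$; $\Phi_-=-\Phi_+$, and $\Phi$ is the disjoint union of $\Phi_+$ and $\Phi_-$. For $z\in W$, $\Phi_z:=\Phi_+\cap z(\Phi_-)$ and $\Phi'_z:=\Phi_+\setminus\Phi_z$.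 The weak (right) order on $W$ is defined by $x\leq y$ iff $l(y)=l(x)+l(x^{-1}y)$ (equivalently $\Phi_x\subseteq\Phi_y$). 2-closure: a subset $\Gamma$ of $\Phi$ is closed if for all $\alpha,\beta\in\Gamma$, $\{a\alpha+b\beta\mid a,b\in\mathbb{R}_{\geq0}\}\cap\Phi\subseteq\Gamma$. For $\Gamma\subseteq\Phi$, $\overline{\Gamma}$ is the intersection of all closed subsets of $\Phi$ containing $\Gamma$. A complete meet semilattice is a poset in which every non-empty subset $X$ has a greatest lower bound $\bigwedge X$; $\bigvee X$ denotes the least upper bound when it exists. *)

(* Defs.v *)
From HB Require Import structures.
From mathcomp Require Import all_boot all_order all_algebra.
From mathcomp Require Import all_classical all_reals all_analysis.
From mathcomp Require Import ring.

Set Implicit Arguments.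
Unset Strict Implicit.
Unset Printing Implicit Defensive.

Import Order.TTheory GRing.Theory Num.Theory.

Local Open Scope classical_set_scope.
Local Open Scope ring_scope.

(* A finite sum over A is a sum over a duplicate-free sequence of elements of A. *)
Definition positively_independent (R : realType) (V : lmodType R)
    (A : set V) : Prop :=
  forall (s : seq V) (c : V -> R),
    uniq s -> (forall a, a \in s -> A a /\ 0 <= c a) ->
    \sum_(a <- s) c a *: a = 0 -> forall a, a \in s -> c a = 0.

(* The simple set may be infinite and need not be linearly independent. *)
Record root_basis (R : realType) (V : lmodType R) := RootBasis {
  form : {symmetric V};
  simple : set V;
  simple_indep : positively_independent simple;
  form_simple1 : forall a, simple a -> form a a = 1;
  form_simple2 : forall a b, simple a -> simple b -> a <> b ->
    (exists2 m : nat, (2 <= m)%N & form a b = - cos (pi / m%:R)) \/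
    form a b <= -1
}.

Section CoxeterGroup.
Variables (R : realType) (V : lmodType R) (D : root_basis V).

Definition refl (a v : V) : V := v - (2 * form D v a) *: a.

(* The subgroup of the bijections V -> V generated by the simple reflections. *)
Inductive generated : (V -> V) -> Prop :=
| generated_refl a : simple D a -> generated (refl a)
| generated_id : generated id
| generated_comp f g : generated f -> generated g -> generated (f \o g)
| generated_inv f g : generated f -> cancel f g -> cancel g f -> generated g.

Record coxeter_group := CoxeterElt {
  cox_fun :> V -> V;
  cox_funP : `[< generated cox_fun >]
}.

HB.instance Definition _ := [isSub for cox_fun].
HB.instance Definition _ := [Choice of coxeter_group by <:].

Lemma refl_invol a : simple D a -> involutive (refl a).
Proof.
move=> /(form_simple1) fa v; rewrite /refl.
rewrite linearBl /= linearZl_LR /= fa mulr1.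
rewrite -addrA -opprD -scalerDl mulrBr.
have -> : 2 * form D v a + (2 * form D v a - 2 * (2 * form D v a)) = 0.
  by ring.
by rewrite scale0r subr0.
Qed.

Lemma generated_bij f : generated f ->
  exists2 g, generated g & cancel f g /\ cancel g f.
Proof.
elim=> [a Da||f1 f2 _ [g1 G1 [K1 L1]] _ [g2 G2 [K2 L2]]|h g Gh _ K L].
- by exists (refl a); [exact: generated_refl|split; exact: refl_invol].
- by exists id => //; exact: generated_id.
- exists (g2 \o g1); first exact: generated_comp.
  by split; exact: can_comp.
- by exists h.
Qed.

Definition cox1 : coxeter_group := CoxeterElt (introT (asboolP _) generated_id).

Definition cox_mul (x y : coxeter_group) : coxeter_group :=
  CoxeterElt (introT (asboolP _)
    (generated_comp (asboolW (cox_funP x)) (asboolW (cox_funP y)))).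

Lemma cox_inv_subproof (x : coxeter_group) :
  exists y : coxeter_group, cancel x y /\ cancel y x.
Proof.
have [g Gg K] := generated_bij (asboolW (cox_funP x)).
by exists (CoxeterElt (introT (asboolP _) Gg)).
Qed.

Definition cox_inv (x : coxeter_group) : coxeter_group :=
  projT1 (cid (cox_inv_subproof x)).

Lemma cox_invK (x : coxeter_group) :
  cancel x (cox_inv x) /\ cancel (cox_inv x) x.
Proof. by rewrite /cox_inv; case: cid. Qed.

Lemma cox_eq (x y : coxeter_group) : x =1 y -> x = y.
Proof. by move=> xy; apply: val_inj; apply: funext. Qed.

Lemma cox_mulA : associative cox_mul.
Proof. by move=> x y z; apply: cox_eq. Qed.

Lemma cox_mul1x : left_id cox1 cox_mul.
Proof. by move=> x; apply: cox_eq. Qed.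

Lemma cox_mulx1 : right_id cox1 cox_mul.
Proof. by move=> x; apply: cox_eq. Qed.

Lemma cox_mulVx : left_inverse cox1 cox_inv cox_mul.
Proof. by move=> x; apply: cox_eq => v /=; case: (cox_invK x) => ->. Qed.

Lemma cox_mulxV : right_inverse cox1 cox_inv cox_mul.
Proof. by move=> x; apply: cox_eq => v /=; case: (cox_invK x) => _ ->. Qed.

HB.instance Definition _ := isGroup.Build coxeter_group
  cox_mulA cox_mul1x cox_mulx1 cox_mulVx cox_mulxV.

Local Open Scope group_scope.

Definition simple_refl : set coxeter_group :=
  [set x | exists2 a, simple D a & cox_fun x = refl a].

Definition has_word (x : coxeter_group) (n : nat) : Prop :=
  exists s : seq coxeter_group,
    [/\ size s = n, forall t, t \in s -> simple_refl t & x = \prod_(t <- s) t].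

Lemma simple_reflV t : simple_refl t -> t^-1 = t.
Proof.
move=> [a Da ta]; apply: mulg1_eq; apply: cox_eq => v.
by rewrite /= ta refl_invol.
Qed.

Lemma has_word1 : has_word 1 0.
Proof. by exists [::]; rewrite big_nil. Qed.

Lemma has_wordM x y m n :
  has_word x m -> has_word y n -> has_word (x * y) (m + n).
Proof.
move=> [s [<- Ss ->]] [t [<- St ->]]; exists (s ++ t).
split; rewrite ?size_cat ?big_cat //= => u.
by rewrite mem_cat => /orP[/Ss|/St].
Qed.

Lemma has_wordV x m : has_word x m -> has_word x^-1 m.
Proof.
move=> [s [<- Ss ->]] {x m}; elim: s Ss => [|t s IHs] Ss.
  by rewrite big_nil invg1; exact: has_word1.
rewrite big_cons invgM /= -addn1; apply: has_wordM.
  by apply: IHs => u us; apply: Ss; rewrite inE us orbT.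
have St : simple_refl t by apply: Ss; rewrite mem_head.
exists [:: t]; rewrite big_seq1 simple_reflV //; split=> // u.
by rewrite inE => /eqP ->.
Qed.

Lemma has_word_exists x : exists n, `[< has_word x n >].
Proof.
suff W f : generated f -> forall y : coxeter_group, cox_fun y = f ->
    exists n, has_word y n.
  by have [n xn] := W _ (asboolW (cox_funP x)) x erefl; exists n; apply/asboolP.
elim=> {x f} [a Da|| f g Gf IHf Gg IHg | f g Gf IHf K L] y yE.
- exists 1%N, [:: y]; rewrite big_seq1; split=> // t.
  by rewrite inE => /eqP ->; exists a.
- exists 0%N; suff -> : y = 1 by exact: has_word1.
  by apply: cox_eq => v; rewrite yE.
- have [m Hm] := IHf (CoxeterElt (introT (asboolP _) Gf)) erefl.
  have [n Hn] := IHg (CoxeterElt (introT (asboolP _) Gg)) erefl.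
  exists (m + n)%N; have := has_wordM Hm Hn; congr has_word.
  by apply: cox_eq => v; rewrite yE.
- pose z := CoxeterElt (introT (asboolP _) Gf).
  have [m Hm] := IHf z erefl.
  exists m; suff -> : y = z^-1 by exact: has_wordV.
  by apply/esym/mulg1_eq/cox_eq => v; rewrite /= yE L.
Qed.

Definition cox_length (x : coxeter_group) : nat := ex_minn (has_word_exists x).

Lemma has_word_length x : has_word x (cox_length x).
Proof. by rewrite /cox_length; case: ex_minnP => m /asboolP. Qed.

Lemma cox_length_le x n : has_word x n -> (cox_length x <= n)%N.
Proof.
by move=> xn; rewrite /cox_length; case: ex_minnP => m _; apply; apply/asboolP.
Qed.

Lemma cox_lengthM x y :
  (cox_length (x * y)%g <= cox_length x + cox_length y)%N.
Proof. by apply/cox_length_le/has_wordM; exact: has_word_length. Qed.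

Lemma cox_length1 : cox_length 1 = 0%N.
Proof. by apply/eqP; rewrite -leqn0; exact/cox_length_le/has_word1. Qed.

Lemma cox_length_eq0 x : cox_length x = 0%N -> x = 1.
Proof.
by move=> x0; have [s] := has_word_length x; rewrite x0 => -[/size0nil -> _ ->];
  rewrite big_nil.
Qed.

Definition weak_le (x y : coxeter_group) : bool :=
  cox_length y == (cox_length x + cox_length (x^-1 * y)%g)%N.

Lemma weak_le_refl : reflexive weak_le.
Proof. by move=> x; rewrite /weak_le mulVg cox_length1 addn0. Qed.

Lemma weak_le_anti : antisymmetric weak_le.
Proof.
move=> x y /andP[/eqP xy /eqP yx].
have /cox_length_eq0 /mulg1_eq : cox_length (x^-1 * y)%g = 0%N.
  by move: xy; rewrite yx -addnA -[LHS]addn0 => /eqP;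
    rewrite eqn_add2l eq_sym addn_eq0 => /andP[_ /eqP].
by rewrite invgK.
Qed.

Lemma weak_le_trans : transitive weak_le.
Proof.
move=> y x z /eqP xy /eqP yz; rewrite /weak_le eqn_leq; apply/andP; split.
  by rewrite -{1}[z](mulVKg x) cox_lengthM.
rewrite yz xy -addnA leq_add2l.
by rewrite -{1}[z](mulVKg y) mulgA cox_lengthM.
Qed.

Fact weak_display : Order.disp_t. Proof. exact: Order.Disp tt tt. Qed.

HB.instance Definition _ := Order.Le_isPOrder.Build weak_display coxeter_group
  weak_le_refl weak_le_anti weak_le_trans.

Lemma weak_leE (x y : coxeter_group) :
  (x <= y)%O = (cox_length y == (cox_length x + cox_length (x^-1 * y)%g)%N).
Proof. by []. Qed.

Local Close Scope group_scope.

Definition roots : set V :=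
  [set v | exists (w : coxeter_group) (a : V), simple D a /\ v = w a].

Definition pos_roots : set V :=
  [set v | roots v /\ exists (s : seq V) (c : V -> R),
    (forall a, a \in s -> simple D a /\ 0 <= c a) /\
    v = \sum_(a <- s) c a *: a].

Definition neg_roots : set V := [set - v | v in pos_roots].

(* Phi_z *)
Definition inv_roots (z : coxeter_group) : set V :=
  pos_roots `&` z @` neg_roots.

(* Phi'_z *)
Definition ninv_roots (z : coxeter_group) : set V := pos_roots `\` inv_roots z.

Definition closed_roots (G : set V) : Prop :=
  G `<=` roots /\
  forall a b : V, G a -> G b -> forall s t : R, 0 <= s -> 0 <= t ->
    roots (s *: a + t *: b) -> G (s *: a + t *: b).

(* The intersection of all closed sets of roots containing G (2-closure). *)
Definition root_closure (G : set V) : set V := smallest closed_roots G.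

End CoxeterGroup.

(* Only non-empty subsets are required to have a greatest lower bound. *)
Definition complete_meet_semilattice (d : Order.disp_t) (T : porderType d) :=
  forall X : set T, X !=set0 -> exists y, infimums X y.

(* Main.v *)
Require Import Defs.
From mathcomp Require Import all_boot all_order all_algebra.
From mathcomp Require Import all_classical all_reals all_analysis.
From mathcomp Require Import ring lra zify.

(** Write [Phi_w] for [inv_roots w], [Phi'_w] for [ninv_roots w] and [l] for the
    length. The positive roots outside [Phi_w] are those that [w^-1] keeps
    positive, so membership in [Phi_w] is a linear condition; both [Phi_w] and
    [Phi'_w] are closed, and [x <= y] holds exactly when [Phi_x] is contained in
    [Phi_y] ([weak_leP]). All this rests on the rule that [w a] is positive
    whenever the reflection in the simple root [a] does not shorten [w]
    ([nonneg_of_length]), which is reduced to subgroups generated by two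
    simple reflections ([dihedral_word]). The simple roots are only
    positively independent, so coordinates are replaced throughout by the fact
    that a simple root spans an extreme ray of their cone ([simple_extreme]).

    Joins. Two covers [u s_a] and [u s_b] of [u] with a common upper bound have
    a join inside the coset of [u] by the two reflections, and its inversions
    outside [Phi_u] lie in the cone of [u a] and [u b], hence in the closure of
    the inversions of the two covers ([join_of_covers]). An induction on the
    interval below an upper bound gives the same for arbitrary pairs
    ([join_below]), and a longest element whose inversions lie in the closure
    of the union is the join of a bounded set ([bounded_join]). The meet of a
    non-empty set is the join of its lower bounds.

    Meets. Let [y] be the meet of [X], let [G] be a closed set containing all
    [Phi'_x], and let [v] be in [Phi'_y]; we show [v] in [G] by induction on the
    depth of [y^-1 v], the least length of an element making that root negative
    ([ninv_glb]). We may assume [v] in [Phi_x] for all [x] in [X]. Descend from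
    [y] to some [c] while the depth of [c^-1 v] keeps dropping, and write
    [v = c d + h (c a)] with [a] simple, [h > 0] and [d] a root of depth less
    than that of [c^-1 v].
    If [c] is as low as possible then [c a] is in [Phi'_y]. It is in some
    [Phi'_x], since otherwise [c s_a] would be a lower bound of [X] that is not
    below [y]; so [c a] is in [G]. Comparing signs under [x^-1] shows that [c d]
    is positive. If [c d] is in [Phi'_y], induction puts it in [G], and then [v]
    too. If [c d] is in [Phi_y], look at the plane of [v] and [c d]: on the way
    from [y] down to [c], the first step that removes an inversion lying in this
    plane reflects [v] to a root [b] of [Phi'_y] of smaller depth, and [v] lies
    in the cone of [c a] and [b] ([plane_reflection]). *)

Set Implicit Arguments.
Unset Strict Implicit.
Unset Printing Implicit Defensive.

Import Order.TTheory GRing.Theory Num.Theory.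

Local Open Scope classical_set_scope.
Local Open Scope ring_scope.

(** * The cone spanned by the simple roots *)

Section Cone.
Variables (R : realType) (V : lmodType R) (D : root_basis V).
Local Notation "<< u , v >>" := (Defs.form D u v) (format "<< u ,  v >>").

Lemma formC u v : <<u, v>> = <<v, u>>.
Proof. by rewrite hermC expr0 mul1r. Qed.

Lemma formDl u v w : <<u + v, w>> = <<u, w>> + <<v, w>>.
Proof. by rewrite linearDl. Qed.

Lemma formZl k u w : <<k *: u, w>> = k * <<u, w>>.
Proof. by rewrite linearZl_LR. Qed.

Lemma formDr u v w : <<w, u + v>> = <<w, u>> + <<w, v>>.
Proof. by rewrite linearDr. Qed.

Lemma formZr k u w : <<w, k *: u>> = k * <<w, u>>.
Proof. by rewrite linearZr_LR. Qed.

Lemma formNl u w : <<- u, w>> = - <<u, w>>.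
Proof. by rewrite linearNl. Qed.

Lemma formNr u w : <<w, - u>> = - <<w, u>>.
Proof. by rewrite linearN. Qed.

Lemma form_simple_le0 a b :
  simple D a -> simple D b -> a <> b -> <<a, b>> <= 0.
Proof.
move=> Da Db /(form_simple2 Da Db)[[m m2 ->]|]; last by lra.
rewrite oppr_le0; apply: cos_ge0_pihalf.
have m2R : (2 : R) <= m%:R by rewrite ler_nat.
have pi0 := pi_gt0 R.
have pim : 0 <= pi / m%:R :> R by rewrite divr_ge0 ?ler0n // ltW.
have pim2 : pi / m%:R <= pi / 2 :> R.
  rewrite ler_pM2l ?pi_gt0 // lef_pV2 // posrE; last by rewrite ltr0n.
  exact: lt_le_trans m2R.
by rewrite pim2 andbT (le_trans _ pim) // oppr_le0 divr_ge0 // ltW.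
Qed.

(** The non-negative combinations of simple roots, in the form in which they
    occur in [pos_roots]. *)
Definition nonneg (v : V) : Prop := exists (s : seq V) (c : V -> R),
  (forall a, a \in s -> simple D a /\ 0 <= c a) /\ v = \sum_(a <- s) c a *: a.

(** A normal form of a non-negative combination; unlike in [nonneg], the
    support may be enlarged at will, so that finitely many combinations can
    be compared coefficientwise. *)
Lemma nonneg_repr v : nonneg v -> exists (s : seq V) (c : V -> R),
  [/\ uniq s, forall a, a \in s -> simple D a, forall a, 0 <= c a &
      forall S, uniq S -> {subset s <= S} -> v = \sum_(a <- S) c a *: a].
Proof.
move=> [s [c [sc ->]]].
exists (undup s), (fun a => (count_mem a s)%:R * (if a \in s then c a else 0)).
split=> [|a|a|S uS sS]; first exact: undup_uniq.
- by rewrite mem_undup => /sc[].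
- by rewrite mulr_ge0 //; case: ifP => // /sc[].
rewrite [RHS](bigID (mem (undup s))) /= [X in _ = _ + X]big1 ?addr0; last first.
  by move=> a; rewrite mem_undup => /negbTE ->; rewrite mulr0 scale0r.
have sSp : perm_eq (seq.filter (mem (undup s)) S) (undup s).
  apply: uniq_perm; [exact: filter_uniq|exact: undup_uniq|move=> a].
  by rewrite mem_filter /= andb_idr // => /sS.
rewrite -[RHS]big_filter (perm_big _ sSp) /=.
rewrite -[LHS]big_undup_iterop_count /= [LHS]big_seq [RHS]big_seq.
apply: eq_bigr => a; rewrite mem_undup => ->.
by rewrite -scalerA scaler_nat.
Qed.

Lemma nonneg0 : nonneg 0.
Proof. by exists [::], (fun=> 0); rewrite big_nil. Qed.

Lemma nonneg_simple a : simple D a -> nonneg a.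
Proof.
move=> Da; exists [:: a], (fun=> 1); rewrite big_seq1 scale1r; split=> // b.
by rewrite inE => /eqP ->; split=> //; exact: ler01.
Qed.

Lemma nonnegZ k v : 0 <= k -> nonneg v -> nonneg (k *: v).
Proof.
move=> k0 [s [c [sc ->]]]; exists s, (fun a => k * c a); split=> [a /sc[Da ca]|].
  by split=> //; exact: mulr_ge0.
by rewrite scaler_sumr; apply: eq_bigr => a _; rewrite scalerA.
Qed.

Lemma nonneg_repr3 u v w : nonneg u -> nonneg v -> nonneg w ->
  exists (S : seq V) (c d e : V -> R),
  [/\ uniq S, forall a, a \in S -> simple D a,
      [/\ forall a, 0 <= c a, forall a, 0 <= d a & forall a, 0 <= e a] &
      [/\ u = \sum_(a <- S) c a *: a, v = \sum_(a <- S) d a *: a &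
          w = \sum_(a <- S) e a *: a]].
Proof.
move=> /nonneg_repr[s [c [us ss c0 uE]]] /nonneg_repr[t [d [ut st d0 vE]]].
move=> /nonneg_repr[r [e [ur sr e0 wE]]].
exists (undup (s ++ t ++ r)), c, d, e; split; first exact: undup_uniq.
- by move=> a; rewrite mem_undup !mem_cat => /or3P[/ss|/st|/sr].
- by [].
by split; [apply: uE|apply: vE|apply: wE]; rewrite ?undup_uniq // => a;
  rewrite mem_undup !mem_cat => ->; rewrite ?orbT.
Qed.

Lemma nonnegD u v : nonneg u -> nonneg v -> nonneg (u + v).
Proof.
move=> nu nv; have [S [c [d [e]]]] := nonneg_repr3 nu nv nonneg0.
move=> [_ simS [c0 d0 _] [-> -> _]].
exists S, (fun a => c a + d a); split=> [a /simS Da|].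
  by split=> //; exact: addr_ge0.
by rewrite -big_split; apply: eq_bigr => a _; rewrite scalerDl.
Qed.

Lemma nonneg_comb x y u v : 0 <= x -> 0 <= y -> nonneg u -> nonneg v ->
  nonneg (x *: u + y *: v).
Proof. by move=> *; apply: nonnegD; apply: nonnegZ. Qed.

(** Positive independence, freed from the representation: the positive cone
    contains no line. *)
Lemma nonneg_addI u v : nonneg u -> nonneg v -> u + v = 0 -> u = 0.
Proof.
move=> nu nv uv0; have [S [c [d [e]]]] := nonneg_repr3 nu nv nonneg0.
move=> [uS simS [c0 d0 _] [uE vE _]].
rewrite uE big_seq big1 // => a aS.
suff -> : c a = 0 by rewrite scale0r.
have : c a + d a = 0.
  apply: (@simple_indep _ _ D S (fun b => c b + d b) uS) => // [b bS|].
    by split; [exact: simS|exact: addr_ge0].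
  rewrite -[RHS]uv0 uE vE -big_split.
  by apply: eq_bigr => b _; rewrite scalerDl.
by have := c0 a; have := d0 a; lra.
Qed.

Lemma nonneg_anti v : nonneg v -> nonneg (- v) -> v = 0.
Proof. by move=> nv nNv; apply: (nonneg_addI nv nNv); rewrite subrr. Qed.

(** Positive independence alone would allow a simple root to lie in the cone of
    the others; it is the sign of the form on pairs of simple roots that makes
    every simple root span an extreme ray. *)
Lemma simple_extreme a k u v : simple D a -> nonneg u -> nonneg v ->
  u + v = k *: a -> exists2 x, 0 <= x & u = x *: a.
Proof.
move=> Da nu nv uvE.
have [S [c [d [e]]]] := nonneg_repr3 nu nv (nonneg_simple Da).
move=> [uS simS [c0 d0 e0] [uE vE aE]].
have aS : a \in S.
  apply: contraT => aS.
  have : <<a, a>> <= 0.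
    rewrite {2}aE raddf_sum big_seq sumr_le0 // => b bS.
    rewrite /= formZr mulr_ge0_le0 //; apply: form_simple_le0 => //.
      exact: simS.
    by move=> ab; rewrite ab bS in aS.
  by rewrite form_simple1 //; lra.
pose f b := c b + d b.
have f0 b : 0 <= f b by exact: addr_ge0.
have uvf : k *: a = f a *: a + \sum_(b <- S | b != a) f b *: b.
  rewrite -uvE uE vE -big_split (bigD1_seq a) //= scalerDl; congr (_ + _).
  by apply: eq_bigr => b _; rewrite scalerDl.
have [kf|kf] := ltP (f a) k.
  have : (k - f a) * <<a, a>> <= 0.
    rewrite -formZr scalerBl uvf addrAC subrr add0r raddf_sum.
    rewrite big_seq_cond sumr_le0 // => b /andP[bS ba].
    rewrite /= formZr mulr_ge0_le0 //; apply: form_simple_le0 => //.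
      exact: simS.
    by apply/eqP; rewrite eq_sym.
  by rewrite form_simple1 //; lra.
exists (c a) => //; rewrite uE (bigD1_seq a) //= big_seq_cond big1 ?addr0 //.
move=> b /andP[bS ba].
suff : f b = 0 by rewrite /f => fb0; rewrite (_ : c b = 0) ?scale0r //;
  have := c0 b; have := d0 b; lra.
pose g b := if b == a then f a - k else f b.
have <- : g b = f b by rewrite /g (negbTE ba).
apply: (@simple_indep _ _ D S g uS) => // [b' b'S|].
  split; first exact: simS.
  by rewrite /g; case: eqP => // _; rewrite subr_ge0.
rewrite (bigD1_seq a) //= {1}/g eqxx scalerBl uvf opprD addNKr.
rewrite [X in _ + X](eq_bigr (fun b => f b *: b)) ?addNr //.
by move=> b' /negbTE b'a; rewrite /g b'a.
Qed.

End Cone.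

(** * Group elements as isometries, and words in two simple reflections *)

Section Isometry.
Variables (R : realType) (V : lmodType R) (D : root_basis V).
Local Notation W := (coxeter_group D).
Local Notation "<< u , v >>" := (Defs.form D u v) (format "<< u ,  v >>").
Implicit Types (x y : W) (u v : V).

Lemma generated_isometry f : generated D f ->
  (forall k u v, f (k *: u + v) = k *: f u + f v) /\
  (forall u v, <<f u, f v>> = <<u, v>>).
Proof.
elim=> {f} [a Da||f g _ [f1 f2] _ [g1 g2]|f g _ [f1 f2] K L].
- split=> [k u v|u v]; rewrite /refl.
    rewrite formDl formZl scalerBr scalerA addrACA -opprD -scalerDl.
    by congr (_ - _ *: _); ring.
  rewrite !(formDl, formDr, formNl, formNr, formZl, formZr) (formC D a v).
  by rewrite form_simple1 //; ring.
- by [].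
- by split=> [k u v|u v] /=; rewrite ?g1 ?f1 ?f2 ?g2.
- split=> [k u v|u v]; last by rewrite -f2 !L.
  by apply: (can_inj K); rewrite L f1 !L.
Qed.

Lemma coxP x k u v : x (k *: u + v) = k *: x u + x v.
Proof. by have [] := generated_isometry (asboolW (cox_funP x)). Qed.

Lemma cox_form x u v : <<x u, x v>> = <<u, v>>.
Proof. by have [] := generated_isometry (asboolW (cox_funP x)). Qed.

Lemma coxD x u v : x (u + v) = x u + x v.
Proof. by rewrite -[u]scale1r coxP !scale1r. Qed.

Lemma cox0 x : x 0 = 0.
Proof. by apply: (addrI (x 0)); rewrite -coxD !addr0. Qed.

Lemma coxZ x k u : x (k *: u) = k *: x u.
Proof. by rewrite -[k *: u]addr0 coxP cox0 addr0. Qed.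

Lemma coxN x u : x (- u) = - x u.
Proof. by rewrite -scaleN1r coxZ scaleN1r. Qed.

Lemma coxB x u v : x (u - v) = x u - x v.
Proof. by rewrite coxD coxN. Qed.

Lemma coxM x y v : (x * y)%g v = x (y v).
Proof. by []. Qed.

Lemma cox1E v : (1%g : W) v = v.
Proof. by []. Qed.

Lemma coxK x v : (x^-1)%g (x v) = v.
Proof. by rewrite -coxM mulVg. Qed.

Lemma coxKV x v : x ((x^-1)%g v) = v.
Proof. by rewrite -coxM mulgV. Qed.

(** The identity is a mere default value, for vectors that are not simple
    roots. *)
Definition srefl (a : V) : W :=
  if pselect (simple D a) is left Da
  then CoxeterElt (introT (asboolP _) (generated_refl Da)) else 1%g.

Lemma sreflE a v : simple D a -> srefl a v = v - (2 * <<v, a>>) *: a.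
Proof. by rewrite /srefl; case: pselect. Qed.

Lemma simple_reflP x : simple_refl x <-> exists2 a, simple D a & x = srefl a.
Proof.
split=> [[a Da xE]|[a Da ->]]; exists a => //.
  by apply: cox_eq => v; rewrite xE sreflE.
by rewrite /srefl; case: pselect.
Qed.

Lemma srefl_self a : simple D a -> srefl a a = - a.
Proof.
move=> Da; rewrite sreflE // form_simple1 // mulr1.
by rewrite scaler_nat mulr2n opprD addrA subrr add0r.
Qed.

Lemma srefl2 a : simple D a -> (srefl a * srefl a)%g = 1%g.
Proof.
move=> Da; apply: cox_eq => v; rewrite coxM cox1E.
by rewrite {1}/srefl /srefl; case: pselect => //= _; exact: refl_invol.
Qed.

Lemma sreflV a : simple D a -> ((srefl a)^-1)%g = srefl a.
Proof. by move=> Da; apply: mulg1_eq; exact: srefl2. Qed.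

Lemma sreflK a v : simple D a -> srefl a (srefl a v) = v.
Proof. by move=> Da; rewrite -coxM srefl2. Qed.

Lemma mulsreflK x a : simple D a -> (x * srefl a * srefl a)%g = x.
Proof. by move=> Da; rewrite -mulgA srefl2 // mulg1. Qed.

End Isometry.

Section Dihedral.
Variables (R : realType) (V : lmodType R) (D : root_basis V).
Local Notation W := (coxeter_group D).
Local Notation "<< u , v >>" := (Defs.form D u v) (format "<< u ,  v >>").
Variables a b : V.
Hypotheses (Da : simple D a) (Db : simple D b) (ab : a <> b).
Local Notation c := (- <<a, b>>).

Definition word (t : seq bool) : W :=
  (\prod_(e <- t) srefl D (if e then a else b))%g.

Lemma word_nil : word [::] = 1%g.
Proof. by rewrite /word big_nil. Qed.

Lemma word_cons e t : word (e :: t) = (srefl D (if e then a else b) * word t)%g.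
Proof. by rewrite /word big_cons. Qed.

Lemma word_cat t u : word (t ++ u) = (word t * word u)%g.
Proof. by rewrite /word big_cat. Qed.

Lemma simple_letter (e : bool) : simple D (if e then a else b).
Proof. by case: e. Qed.

Lemma word_rev t : word (rev t) = ((word t)^-1)%g.
Proof.
elim: t => [|e t IHt]; first by rewrite word_nil invg1.
rewrite rev_cons -cats1 word_cat IHt !word_cons word_nil mulg1 invgM.
by rewrite sreflV //; exact: simple_letter.
Qed.

Lemma srefl_comb_a x y :
  srefl D a (x *: a + y *: b) = (2 * c * y - x) *: a + y *: b.
Proof.
rewrite sreflE // formDl !formZl form_simple1 // (formC D b).
rewrite addrAC -scalerBl; congr (_ *: _ + _); ring.
Qed.

Lemma srefl_comb_b x y :
  srefl D b (x *: a + y *: b) = x *: a + (2 * c * x - y) *: b.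
Proof.
rewrite sreflE // formDl !formZl form_simple1 //.
rewrite -addrA -scalerBl; congr (_ + _ *: _); ring.
Qed.

(** The alternating word of length [k] whose last letter is the reflection
    in [b]. *)
Fixpoint alt k : seq bool := if k is k'.+1 then odd k' :: alt k' else [::].

Lemma size_alt k : size (alt k) = k.
Proof. by elim: k => //= k ->. Qed.

Lemma alt_split k m : exists2 t, size t = k & alt (k + m) = t ++ alt m.
Proof.
elim: k => [|k [t tk altE]]; first by exists [::].
by exists (odd (k + m) :: t); rewrite /= ?tk ?altE.
Qed.

(** Along alternating words, the coordinates in the basis [a], [b] are
    consecutive terms of a solution [q] of the Chebyshev recurrence. *)
Lemma word_alt_rec (q : nat -> R) k :
  (forall n, q n.+2 = 2 * c * q n.+1 - q n) ->
  word (alt k) (q 1%N *: a + q 0%N *: b) =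
  if odd k then q k *: a + q k.+1 *: b else q k.+1 *: a + q k *: b.
Proof.
move=> qE; elim: k => [|k IHk]; first by rewrite word_nil cox1E.
rewrite word_cons coxM IHk /=; case: (odd k) => /=.
  by rewrite srefl_comb_a qE.
by rewrite srefl_comb_b qE.
Qed.

Lemma word_perp t v : <<v, a>> = 0 -> <<v, b>> = 0 -> word t v = v.
Proof.
move=> va vb; elim: t => [|e t IHt]; first by rewrite word_nil.
rewrite word_cons coxM IHt sreflE; last exact: simple_letter.
by rewrite (_ : <<v, _>> = 0) ?mulr0 ?scale0r ?subr0 //; case: e.
Qed.

(** This plays the role of a descent for the length function of the subgroup
    generated by the two reflections. *)
Definition shortens t :=
  exists2 t', (size t' < size t)%N & word t' = (word t * srefl D a)%g.

Lemma shortens_cat t u : shortens u -> shortens (t ++ u).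
Proof.
move=> [u' su' u'E]; exists (t ++ u'); first by rewrite !size_cat ltn_add2l.
by rewrite !word_cat u'E mulgA.
Qed.

Lemma shortens_or_alt t : t = alt (size t) \/ shortens t.
Proof.
elim: t => [|e t [tE|st]]; first by left.
  rewrite tE /= size_alt; set k := size t.
  have [<-|ek] := eqVneq e (odd k); first by left.
  right; case: k ek => [|k] /=.
    case: e => // _; exists [::] => //.
    by rewrite word_cons word_nil mulg1 srefl2.
  move=> ek; have {ek} -> : e = odd k by case: e ek; case: odd.
  exists (alt k ++ [:: true]); first by rewrite size_cat /= size_alt addn1.
  rewrite word_cat !word_cons word_nil mulg1; congr (_ * _)%g.
  by rewrite mulgA srefl2 ?mul1g //; exact: simple_letter.
by right; exact: (shortens_cat [:: e]).
Qed.

Definition in_cone2 v := exists x y, [/\ 0 <= x, 0 <= y & v = x *: a + y *: b].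

Lemma infinite_alt_cone k : 1 <= c -> in_cone2 (word (alt k) a).
Proof.
move=> c1; suff [x [y [x0 xy ->]]] : exists x y, [/\ 0 <= x, x <= y &
    word (alt k) a = if odd k then x *: a + y *: b else y *: a + x *: b].
  by case: odd; [exists x, y|exists y, x]; split=> //; exact: le_trans xy.
elim: k => [|k [x [y [x0 xy IHk]]]].
  exists 0, 1; rewrite /= word_nil cox1E scale1r scale0r addr0; split=> //.
exists y, (2 * c * y - x); rewrite word_cons coxM IHk /=.
split; [exact: le_trans xy|nra|].
by case: (odd k) => /=; rewrite ?srefl_comb_a ?srefl_comb_b.
Qed.

Section FiniteOrder.
Variable m : nat.
Hypotheses (m2 : (2 <= m)%N) (cE : <<a, b>> = - cos (pi / m%:R)).
Let t : R := pi / m%:R.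

Let m_gt0 : (0 : R) < m%:R.
Proof. by rewrite ltr0n; lia. Qed.

Let mt : m%:R * t = pi.
Proof. by rewrite /t mulrC divfK // gt_eqF. Qed.

Let t_gt0 : 0 < t.
Proof. by rewrite divr_gt0 ?pi_gt0. Qed.

Let sin_t_gt0 : 0 < sin t.
Proof.
apply: sin_gt0_pi; rewrite t_gt0 /= -mt.
have : (2 : R) <= m%:R by rewrite ler_nat.
by have := t_gt0; nra.
Qed.

Let cheb s r : cos s = cos t -> forall n : nat,
  sin (n.+2%:R * s + r) / sin t =
  2 * c * (sin (n.+1%:R * s + r) / sin t) - sin (n%:R * s + r) / sin t.
Proof.
move=> st n; rewrite cE opprK -/t -st.
have -> : n.+2%:R * s + r = (n.+1%:R * s + r) + s.
  by rewrite -[n.+2]addn1 natrD; ring.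
have -> : n%:R * s + r = (n.+1%:R * s + r) - s.
  by rewrite -[n.+1]addn1 natrD; ring.
by rewrite sinB sinD; ring.
Qed.

Let word_alt_a k :
  let q n := sin (n%:R * t + 0) / sin t in
  word (alt k) a =
  if odd k then q k *: a + q k.+1 *: b else q k.+1 *: a + q k *: b.
Proof.
move=> q; rewrite -(@word_alt_rec q) /q; last exact: cheb.
by rewrite mul1r mul0r !addr0 sin0 divff ?gt_eqF // mul0r scale1r scale0r addr0.
Qed.

Let word_alt_b k :
  let q n := sin (n%:R * - t + t) / sin t in
  word (alt k) b =
  if odd k then q k *: a + q k.+1 *: b else q k.+1 *: a + q k *: b.
Proof.
move=> q; rewrite -(@word_alt_rec q) /q; last by apply: cheb; rewrite cosN.
rewrite mul1r mul0r addNr add0r sin0 divff ?gt_eqF // mul0r.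
by rewrite scale1r scale0r add0r.
Qed.

Lemma finite_alt_cone k : (k < m)%N -> in_cone2 (word (alt k) a).
Proof.
move=> km; rewrite word_alt_a.
have q0 n : (n <= m)%N -> 0 <= sin (n%:R * t + 0) / sin t.
  move=> nm; rewrite addr0 divr_ge0 ?(ltW sin_t_gt0) // sin_ge0_pi //.
  rewrite mulr_ge0 ?ler0n ?(ltW t_gt0) //= -mt ler_pM2r ?t_gt0 //.
  by rewrite ler_nat.
by case: odd; do 2 eexists; (split; last reflexivity); apply: q0; lia.
Qed.

(** The braid relation: the alternating word of length [2m] is the identity,
    since it fixes [a], [b] and everything orthogonal to both, and the form is
    non-degenerate on the plane of [a] and [b]. *)
Lemma word_alt_relation : word (alt (m + m)) = 1%g.
Proof.
have m2t : (m + m)%:R * t = pi *+ 2 by rewrite natrD mulrDl mt mulr2n.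
have odd0 : odd (m + m) = false by rewrite addnn odd_double.
have Ea : word (alt (m + m)) a = a.
  rewrite word_alt_a odd0 !addr0 -[(m + m).+1]addn1 natrD mulrDl mul1r m2t.
  rewrite [_ + t]addrC sinD2pi sin2pi mul0r scale0r addr0.
  by rewrite divff ?scale1r // gt_eqF.
have Eb : word (alt (m + m)) b = b.
  rewrite word_alt_b odd0 -[(m + m).+1]addn1 natrD mulrDl mul1r mulrN m2t subrK.
  rewrite sinN sin2pi oppr0 mul0r scale0r add0r -sinD2pi addrAC addNr add0r.
  by rewrite divff ?scale1r // gt_eqF.
apply: cox_eq => v; rewrite cox1E.
pose x := (<<v, a>> + c * <<v, b>>) / (1 - c ^+ 2).
pose y := (<<v, b>> + c * <<v, a>>) / (1 - c ^+ 2).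
have c2 : 1 - c ^+ 2 != 0.
  by rewrite cE opprK -sin2cos2 expf_neq0 // gt_eqF.
pose w := v - (x *: a + y *: b).
have wa : <<w, a>> = 0.
  rewrite /w formDl formNl formDl !formZl form_simple1 // (formC D b a) /x /y.
  by field.
have wb : <<w, b>> = 0.
  by rewrite /w formDl formNl formDl !formZl form_simple1 // /x /y; field.
have : v = w + (x *: a + y *: b) by rewrite /w subrK.
move: (w) wa wb => w' wa wb ->.
by rewrite !coxD !coxZ Ea Eb word_perp.
Qed.

(** By the braid relation, the final alternating factor of length [m] can be
    rewritten so as to end in the reflection in [a]. *)
Lemma shortens_alt k : (m <= k)%N -> shortens (alt k).
Proof.
move=> mk; have [u _] := alt_split (k - m) m.
rewrite subnK // => ->; apply: shortens_cat.
have [[|e w] wm altE] := alt_split m m; first by move: wm m2 => /= <-.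
have eE : e = true.
  case: (m) m2 altE => [|m'] // _; rewrite addSn /= => -[<- _].
  by rewrite addnS /= addnn odd_double.
exists (rev w); first by rewrite size_rev size_alt -wm.
rewrite word_rev; apply: mulg1_eq.
have := word_alt_relation; rewrite altE word_cat word_cons eE => rel.
have /mulg1_eq swE : (srefl D a * (word w * word (alt m)))%g = 1%g.
  by rewrite mulgA.
by rewrite mulgA -swE sreflV // srefl2.
Qed.

End FiniteOrder.

(** The rank two case of the sign rule. For a reduced word [t], the second
    alternative says that the reflection in [a] is a right descent of
    [word t]. *)
Lemma dihedral_word t : in_cone2 (word t a) \/ shortens t.
Proof.
have [->|] := shortens_or_alt t; last by right.
set k := size t; have [[m m2 cE]|c1] := form_simple2 Da Db ab; last first.
  by left; apply: infinite_alt_cone; rewrite lerNr.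
have [km|mk] := ltnP k m; first by left; exact: (finite_alt_cone m2 cE).
by right; exact: (shortens_alt m2 cE).
Qed.

Lemma dihedral_sign t : in_cone2 (word t a) \/ in_cone2 (- word t a).
Proof.
have [n] := ubnP (size t); elim: n t => // n IHn t tn.
have [|[t' t't t'E]] := dihedral_word t; first by left.
have -> : word t a = - word t' a by rewrite t'E coxM srefl_self // coxN opprK.
rewrite opprK; have [||] := IHn t'; [exact: leq_trans t't _|by right|by left].
Qed.

End Dihedral.

Section DihedralSwap.
Variables (R : realType) (V : lmodType R) (D : root_basis V).
Variables a b : V.
Hypotheses (Da : simple D a) (Db : simple D b) (ab : a <> b).

Lemma word_swap t : word D b a (map negb t) = word D a b t.
Proof. by rewrite /word big_map; apply: eq_bigr => -[]. Qed.

Lemma dihedral_sign_letter t (e : bool) (c := if e then a else b) :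
  in_cone2 a b (word D a b t c) \/ in_cone2 a b (- word D a b t c).
Proof.
have swap v : in_cone2 b a v -> in_cone2 a b v.
  by move=> [x [y [x0 y0 ->]]]; exists y, x; rewrite addrC.
rewrite {}/c; case: e; first exact: dihedral_sign.
have ba : b <> a by move=> /esym.
rewrite -word_swap.
by have [/swap|/swap] := dihedral_sign Db Da ba (map negb t); [left|right].
Qed.

End DihedralSwap.

(** * Signs of roots and inversion sets *)

Section Sign.
Variables (R : realType) (V : lmodType R) (D : root_basis V).
Local Notation W := (coxeter_group D).
Local Notation "<< u , v >>" := (Defs.form D u v) (format "<< u ,  v >>").
Local Notation l := (@cox_length R V D).
Local Notation nonneg := (nonneg D).
Local Notation roots := (@Defs.roots R V D).
Local Notation s_ := (srefl D).
Implicit Types (x y z w : W) (u v a b : V).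

Lemma length_srefl a : simple D a -> (l (s_ a) <= 1)%N.
Proof.
move=> Da; apply: cox_length_le; exists [:: s_ a]; rewrite big_seq1; split=> //.
by move=> t; rewrite inE => /eqP ->; apply/simple_reflP; exists a.
Qed.

Lemma length_word a b t : simple D a -> simple D b ->
  (l (word D a b t) <= size t)%N.
Proof.
move=> Da Db; elim: t => [|e t IHt]; first by rewrite word_nil cox_length1.
rewrite word_cons (leq_trans (cox_lengthM _ _)) //= -add1n leq_add //.
by apply: length_srefl; case: e.
Qed.

Lemma lengthV x : l (x^-1)%g = l x.
Proof.
have le y : (l (y^-1)%g <= l y)%N.
  by apply: cox_length_le; apply: has_wordV; exact: has_word_length.
by apply/eqP; rewrite eqn_leq le -{1}[x]invgK le.
Qed.

Lemma lengthMsrefl_le x a : simple D a -> (l (x * s_ a)%g <= (l x).+1)%N.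
Proof.
move=> Da; rewrite (leq_trans (cox_lengthM _ _)) // -addn1 leq_add2l.
exact: length_srefl.
Qed.

Lemma right_descent x : x <> 1%g ->
  exists2 b, simple D b & (l (x * s_ b)%g < l x)%N.
Proof.
move=> x1; have [s [sx Ss xE]] := has_word_length x.
case/lastP: s sx Ss xE => [_ _|s t]; first by rewrite big_nil.
rewrite size_rcons => <- Ss.
have /simple_reflP[b Db tE] : simple_refl t.
  by apply: Ss; rewrite mem_rcons mem_head.
rewrite -cats1 big_cat big_seq1 /= => xE; exists b => //.
rewrite ltnS; apply: cox_length_le; exists s; split=> //.
  by move=> u us; apply: Ss; rewrite mem_rcons inE us orbT.
by rewrite xE tE mulsreflK.
Qed.

(** The core of the theory, by induction on the length of [w]: pull out of [w]
    a longest possible right factor [word t] in the reflections in [a] and in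
    some right descent [b]. The remaining factor [v] is shorter than [w] and
    has neither descent, so it maps [a] and [b] into the positive cone, while
    [word t] maps [a] into the cone of [a] and [b] by the rank two case. *)
Lemma nonneg_of_length w a : simple D a ->
  (l w <= l (w * s_ a)%g)%N -> nonneg (w a).
Proof.
have [n] := ubnP (l w); elim: n w a => // n IHn w a wn Da wa.
have [->|/eqP w1] := eqVneq w 1%g; first exact: nonneg_simple.
have [b Db wb] := right_descent w1.
have ab : a <> b by move=> ab; move: wa; rewrite ab leqNgt wb.
pose P k := `[< exists (v : W) t,
  [/\ l v = k, w = (v * word D a b t)%g & (k + size t)%N = l w] >].
have Pb : P (l (w * s_ b)%g).
  apply/asboolP; exists (w * s_ b)%g, [:: false]; split=> //.
    by rewrite word_cons word_nil mulg1 mulsreflK.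
  apply/eqP; rewrite eqn_leq addn1 wb /=.
  by rewrite -{1}[w](mulsreflK _ Db) lengthMsrefl_le.
have exP : exists k, P k by exists (l (w * s_ b)%g).
have [k /asboolP[v [t [vk wE wl]]] kmin] := ex_minnP exP.
have kw : (k < l w)%N by exact: leq_ltn_trans (kmin _ Pb) wb.
have vup e : (l v <= l (v * s_ (if e then a else b))%g)%N.
  have De : simple D (if e then a else b) by case: e.
  rewrite leqNgt; apply/negP => ve.
  set v' := (v * _)%g in ve; have wE' : w = (v' * word D a b (e :: t))%g.
    by rewrite word_cons mulgA mulsreflK.
  have : (l w <= l v' + size (e :: t))%N.
    rewrite {1}wE' (leq_trans (cox_lengthM _ _)) // leq_add2l.
    exact: length_word.
  move=> /= wv'; suff /kmin : P (l v') by rewrite -vk leqNgt ve.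
  by apply/asboolP; exists v', (e :: t); split=> //=; lia.
have va : nonneg (v a) by apply: IHn => //; [lia|exact: (vup true)].
have vb : nonneg (v b) by apply: IHn => //; [lia|exact: (vup false)].
have [[x [y [x0 y0 tE]]]|[t' tt' t'E]] := dihedral_word Da Db ab t.
  by rewrite wE coxM tE coxD !coxZ; exact: nonneg_comb.
have : (l (w * s_ a)%g <= l v + size t')%N.
  rewrite wE -mulgA -t'E (leq_trans (cox_lengthM _ _)) // leq_add2l.
  exact: length_word.
by lia.
Qed.

Lemma root_simple a : simple D a -> roots a.
Proof. by move=> Da; exists 1%g, a. Qed.

Lemma rootP v : roots v -> <<v, v>> = 1.
Proof. by move=> [w [a [Da ->]]]; rewrite cox_form form_simple1. Qed.

Lemma root_act x v : roots v -> roots (x v).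
Proof. by move=> [w [a [Da ->]]]; exists (x * w)%g, a. Qed.

Lemma rootN v : roots v -> roots (- v).
Proof.
move=> [w [a [Da ->]]]; exists (w * s_ a)%g, a; split=> //.
by rewrite coxM srefl_self // coxN.
Qed.

Lemma root_sign v : roots v -> nonneg v \/ nonneg (- v).
Proof.
move=> [w [a [Da ->]]]; have [wa|wa] := leqP (l w) (l (w * s_ a)%g).
  by left; exact: nonneg_of_length.
right; rewrite -coxN -(srefl_self Da) -coxM; apply: nonneg_of_length => //.
by rewrite mulsreflK // ltnW.
Qed.

Lemma root_nonnegN v : roots v -> nonneg v -> ~ nonneg (- v).
Proof.
move=> rv nv /(nonneg_anti nv) v0; have := rootP rv.
by rewrite v0 linear0l => /esym/eqP; rewrite oner_eq0.
Qed.

Lemma length_up w a : simple D a -> nonneg (w a) -> l (w * s_ a)%g = (l w).+1.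
Proof.
move=> Da wa; apply/eqP; rewrite eqn_leq lengthMsrefl_le //= ltnNge.
apply/negP => le; apply: (root_nonnegN _ wa); first by exists w, a.
rewrite -coxN -(srefl_self Da) -coxM; apply: nonneg_of_length => //.
by rewrite mulsreflK.
Qed.

Lemma length_down w a : simple D a -> nonneg (- w a) ->
  l w = (l (w * s_ a)%g).+1.
Proof.
move=> Da wa; rewrite -[LHS](congr1 l (mulsreflK w Da)); apply: length_up => //.
by rewrite coxM srefl_self // coxN.
Qed.

Lemma descent_nonneg w a : simple D a -> (l (w * s_ a)%g < l w)%N ->
  nonneg (- w a).
Proof.
move=> Da wa; have [|//] : nonneg (w a) \/ nonneg (- w a).
  by apply: root_sign; exists w, a.
by move=> /(length_up Da) wE; lia.
Qed.

Lemma ascent_nonneg w a : simple D a -> (l w < l (w * s_ a)%g)%N ->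
  nonneg (w a).
Proof. by move=> Da wa; apply: nonneg_of_length => //; exact: ltnW. Qed.

Lemma left_descent w : w <> 1%g -> exists2 a, simple D a &
  nonneg (- (w^-1)%g a) /\ l w = (l (s_ a * w)%g).+1.
Proof.
move=> w1; have [|a Da wa] := @right_descent (w^-1)%g.
  by move=> /(congr1 (fun x => x^-1)%g); rewrite invgK invg1.
have nwa := descent_nonneg Da wa; exists a => //; split=> //.
by rewrite -lengthV (length_down Da nwa) -[l (_ * _)%g]lengthV invgM invgK sreflV.
Qed.

Lemma pos_simple a : simple D a -> pos_roots D a.
Proof. by move=> Da; split; [exact: root_simple|exact: nonneg_simple]. Qed.

(** A simple root is extreme in the positive cone, hence it is the only
    positive root made negative by its reflection. *)
Lemma srefl_pos a v : simple D a -> pos_roots D v -> v <> a ->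
  pos_roots D (s_ a v).
Proof.
move=> Da [rv nv] va; have rsv := root_act (s_ a) rv; split=> //.
have [//|nsv] := root_sign rsv; exfalso; apply: va.
have [x x0 vE] : exists2 x, 0 <= x & v = x *: a.
  apply: (simple_extreme (k := 2 * <<v, a>>) Da nv nsv).
  by rewrite sreflE // opprB addrC subrK.
have := rootP rv; rewrite vE formZl formZr form_simple1 // mulr1 => x1.
by rewrite (_ : x = 1) ?scale1r //; nra.
Qed.

Lemma inv_rootsP w v :
  inv_roots w v <-> pos_roots D v /\ nonneg (- (w^-1)%g v).
Proof.
split=> [[pv [_ [u [ru nu] <-] vE]]|[pv nv]].
  by split=> //; rewrite -vE coxK opprK.
split=> //; exists ((w^-1)%g v); last by rewrite coxKV.
exists (- (w^-1)%g v); last by rewrite opprK.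
by split=> //; apply/rootN/root_act; case: pv.
Qed.

Lemma ninv_rootsP w v :
  ninv_roots w v <-> pos_roots D v /\ nonneg ((w^-1)%g v).
Proof.
split=> [[pv nv]|[pv nv]]; split=> //.
  have rv := root_act (w^-1)%g pv.1.
  by have [//|nwv] := root_sign rv; case: nv; apply/inv_rootsP.
move=> /inv_rootsP[_]; apply: root_nonnegN => //.
by apply: root_act; case: pv.
Qed.

Lemma pos_inv_or_ninv w v : pos_roots D v -> inv_roots w v \/ ninv_roots w v.
Proof. by move=> pv; have [|] := pselect (inv_roots w v); [left|right]. Qed.

Lemma inv_ninvF w v : inv_roots w v -> ~ ninv_roots w v.
Proof. by move=> iv [_]. Qed.

Lemma ninv_inv w v : pos_roots D v -> ~ ninv_roots w v -> inv_roots w v.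
Proof. by move=> /(pos_inv_or_ninv w)[]. Qed.

Lemma pos_comb u v p q : nonneg u -> nonneg v -> 0 <= p -> 0 <= q ->
  roots (p *: u + q *: v) -> pos_roots D (p *: u + q *: v).
Proof. by move=> nu nv p0 q0 r; split=> //; exact: nonneg_comb. Qed.

Lemma inv_closed w : closed_roots D (inv_roots w).
Proof.
split=> [v /inv_rootsP[[]]//|u v].
move=> /inv_rootsP[[_ nu] wu] /inv_rootsP[[_ nv] wv] p q p0 q0 r.
apply/inv_rootsP; split; first exact: pos_comb.
by rewrite coxD !coxZ opprD -!scalerN; exact: nonneg_comb.
Qed.

Lemma ninv_closed w : closed_roots D (ninv_roots w).
Proof.
split=> [v /ninv_rootsP[[]]//|u v].
move=> /ninv_rootsP[[_ nu] wu] /ninv_rootsP[[_ nv] wv] p q p0 q0 r.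
apply/ninv_rootsP; split; first exact: pos_comb.
by rewrite coxD !coxZ; exact: nonneg_comb.
Qed.

(** Multiplying on the right by [s_a] crosses a single wall: [s_a] permutes the
    positive roots other than [a]. *)
Lemma inv_step w a : simple D a -> nonneg (w a) ->
  forall v, inv_roots (w * s_ a)%g v <-> inv_roots w v \/ v = w a.
Proof.
move=> Da wa v; have rwa : roots (w a) by exists w, a.
have E u : ((w * s_ a)^-1)%g u = s_ a ((w^-1)%g u).
  by rewrite invgM sreflV.
split=> [/inv_rootsP[pv]|[/inv_rootsP[pv nv]|->]].
- rewrite E => nv; have rv := root_act (w^-1)%g pv.1.
  have [nwv|nwv] := root_sign rv; last by left; apply/inv_rootsP.
  right; have [<-|va] := pselect ((w^-1)%g v = a); first by rewrite coxKV.
  have [rsv nsv] := srefl_pos Da (conj rv nwv) va.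
  by case: (root_nonnegN rsv nsv).
- apply/inv_rootsP; split=> //; rewrite E -coxN.
  apply: (srefl_pos Da _ _).2; first by split=> //; apply/rootN/root_act; case: pv.
  move=> va; apply: (root_nonnegN rwa wa).
  by rewrite -va coxN coxKV opprK; case: pv.
- apply/inv_rootsP; split=> //; rewrite E coxK srefl_self // opprK.
  exact: nonneg_simple.
Qed.

Lemma inv_sub_mul x z :
  l (x * z)%g = (l x + l z)%N -> inv_roots x `<=` inv_roots (x * z)%g.
Proof.
have [n] := ubnP (l z); elim: n z => // n IHn z zn xz.
have [->|/eqP z1] := eqVneq z 1%g; first by rewrite mulg1.
have [b Db zb] := right_descent z1.
have zE := length_down Db (descent_nonneg Db zb).
have xzE : l (x * (z * s_ b))%g = (l x + l (z * s_ b)%g)%N.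
  apply/eqP; rewrite eqn_leq cox_lengthM /=.
  have := lengthMsrefl_le (x * (z * s_ b))%g Db; rewrite mulgA mulsreflK // xz zE.
  by rewrite addnS ltnS.
have xup : nonneg ((x * (z * s_ b))%g b).
  by apply: ascent_nonneg => //; rewrite xzE mulgA mulsreflK // xz zE addnS.
apply: subset_trans (IHn _ _ xzE) _; first by lia.
move=> v iv; rewrite -[z](mulsreflK _ Db) mulgA.
by apply/(inv_step Db xup); left.
Qed.

(** For the converse, strip from [x] a first letter [b]: it is an inversion of
    [x], hence of [y], so it is also a possible first letter of [y]. *)
Lemma weak_leP x y : (x <= y)%O <-> inv_roots x `<=` inv_roots y.
Proof.
split=> [|]; first by rewrite weak_leE => /eqP xy;
  rewrite -[y](mulVKg x); apply: inv_sub_mul; rewrite mulVKg.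
have [n] := ubnP (l x); elim: n x y => // n IHn x y xn xy.
have [->|/eqP x1] := eqVneq x 1%g.
  by rewrite weak_leE invg1 mul1g cox_length1 add0n.
have [b Db [xb xE]] := left_descent x1.
have ib : inv_roots x b by apply/inv_rootsP; split=> //; exact: pos_simple.
have /inv_rootsP[_ yb] := xy _ ib.
have y1 : y <> 1%g.
  move=> yE; move: yb; rewrite yE invg1 cox1E; apply: root_nonnegN.
    exact: root_simple.
  exact: nonneg_simple.
have yE : l y = (l (s_ b * y)%g).+1.
  rewrite -lengthV (length_down Db yb) -[l (_ * _)%g]lengthV invgM invgK.
  by rewrite sreflV.
have : ((s_ b * x)%g <= (s_ b * y)%g)%O.
  apply: IHn => [|v /inv_rootsP[pv nv]]; first by lia.
  have E (w : W) : ((s_ b * w)^-1)%g v = (w^-1)%g (s_ b v).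
    by rewrite invgM sreflV.
  move: nv; rewrite E => nv; have vb : v <> b.
    move=> vb; move: nv; rewrite vb srefl_self // coxN opprK => nb.
    by apply: (root_nonnegN _ nb xb); apply/root_act/root_simple.
  have /xy/inv_rootsP[_ ysv] : inv_roots x (s_ b v).
    by apply/inv_rootsP; split=> //; exact: srefl_pos.
  by apply/inv_rootsP; rewrite E.
rewrite !weak_leE invgM -mulgA sreflV // [(s_ b * (_ * _))%g]mulgA srefl2 //.
by rewrite mul1g yE xE addSn eqSS.
Qed.

Lemma weak_le_length x y : (x <= y)%O -> (l x <= l y)%N.
Proof. by rewrite weak_leE => /eqP ->; exact: leq_addr. Qed.

Lemma weak_le_length_eq x y : (x <= y)%O -> (l y <= l x)%N -> x = y.
Proof.
rewrite weak_leE => /eqP -> xy; apply/esym.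
have /cox_length_eq0 xy1 : l (x^-1 * y)%g = 0%N by lia.
by rewrite -[y](mulVKg x) xy1 mulg1.
Qed.

Lemma weak_le1 x : ((1%g : W) <= x)%O.
Proof. by rewrite weak_leE invg1 mul1g cox_length1. Qed.

End Sign.

(** * Joins *)

Section Join.
Variables (R : realType) (V : lmodType R) (D : root_basis V).
Local Notation W := (coxeter_group D).
Local Notation l := (@cox_length R V D).
Local Notation nonneg := (nonneg D).
Local Notation roots := (@Defs.roots R V D).
Local Notation s_ := (srefl D).
Implicit Types (x y z w : W) (u v a b : V).

Lemma weak_cover x a : simple D a -> nonneg (x a) -> (x <= (x * s_ a)%g)%O.
Proof.
move=> Da xa; apply/weak_leP => v xv.
by apply/(inv_step Da xa); left.
Qed.

Lemma weak_cover_le x z a : simple D a -> (x <= z)%O -> inv_roots z (x a) ->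
  ((x * s_ a)%g <= z)%O.
Proof.
move=> Da /weak_leP xz zxa; apply/weak_leP => v.
have xa : nonneg (x a) by have /inv_rootsP[[]] := zxa.
by move=> /(inv_step Da xa)[/xz//|->].
Qed.

Lemma weak_lt_cover x z : (x <= z)%O -> x <> z -> exists2 a, simple D a &
  [/\ nonneg (x a), inv_roots z (x a) & ((x * s_ a)%g <= z)%O].
Proof.
move=> xz xNz; have [|a Da [za _]] := @left_descent _ _ D (x^-1 * z)%g.
  by move=> /mulg1_eq; rewrite invgK.
rewrite invgM invgK coxM in za.
have rxa : roots (x a) by apply/root_act/root_simple.
have xa : nonneg (x a).
  have [//|nxa] := root_sign rxa.
  have : inv_roots x (- x a).
    apply/inv_rootsP; split; first by split=> //; exact: rootN.
    by rewrite coxN opprK coxK; exact: nonneg_simple.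
  move: xz => /weak_leP xz /xz /inv_rootsP[_].
  rewrite coxN opprK => /root_nonnegN[]//; exact: root_act.
have zxa : inv_roots z (x a) by apply/inv_rootsP.
by exists a => //; split=> //; exact: weak_cover_le.
Qed.

(** Such a [j] is automatically the join of [x] and [y]; unlike being a join,
    the generation of its inversions is easily carried through iterated
    joins. *)
Definition closure_join x y j := [/\ (x <= j)%O, (y <= j)%O &
  forall G, closed_roots D G -> inv_roots x `<=` G -> inv_roots y `<=` G ->
    inv_roots j `<=` G].

Lemma closure_join_le x y j z :
  closure_join x y j -> (x <= z)%O -> (y <= z)%O -> (j <= z)%O.
Proof.
move=> [_ _ jG] /weak_leP xz /weak_leP yz; apply/weak_leP.
by apply: jG => //; exact: inv_closed.
Qed.

(** The elements of a coset of the group of two simple reflections only add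
    to the inversions of a common lower bound [x] roots in the plane of [x a]
    and [x b]. *)
Lemma inv_word x a b t v : simple D a -> simple D b -> a <> b ->
  nonneg (x a) -> nonneg (x b) -> inv_roots (x * word D a b t)%g v ->
  inv_roots x v \/ exists p q, [/\ 0 <= p, 0 <= q & v = p *: x a + q *: x b].
Proof.
move=> Da Db ab xa xb.
elim/last_ind: t v => [|t e IHt] v; first by rewrite word_nil mulg1; left.
rewrite -cats1 word_cat word_cons word_nil mulg1 mulgA.
set w := (x * word D a b t)%g; set c := if e then a else b.
have Dc : simple D c by rewrite /c; case: (e).
have rwc : roots (w c) by apply/root_act/root_simple.
have [wc|wc] := root_sign rwc.
  move=> /(inv_step Dc wc)[/IHt//|->]; right.
  have [[p [q [p0 q0 E]]]|[p [q [p0 q0 E]]]] :=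
    dihedral_sign_letter Da Db ab t e.
    by exists p, q; split=> //; rewrite /w coxM E coxD !coxZ.
  case: (root_nonnegN rwc wc).
  by rewrite /w coxM -coxN E coxD !coxZ; exact: nonneg_comb.
move=> iv; apply: IHt; rewrite -/w -[w](mulsreflK _ Dc).
have wsc : nonneg ((w * s_ c)%g c) by rewrite coxM srefl_self // coxN.
by apply/(inv_step Dc wsc); left.
Qed.

(** The join of two covers [x s_a] and [x s_b] of [x] below [z]: among the
    elements [x * word t] between [x] and [z], a longest one has both
    reflections as descents, and hence inverts both [x a] and [x b]. *)
Lemma join_of_covers x z a b : simple D a -> simple D b -> a <> b ->
  nonneg (x a) -> nonneg (x b) ->
  inv_roots z (x a) -> inv_roots z (x b) -> (x <= z)%O ->
  exists j, closure_join (x * s_ a)%g (x * s_ b)%g j.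
Proof.
move=> Da Db ab xa xb zxa zxb xz.
pose P n := `[< exists t (w := (x * word D a b t)%g),
  [/\ (x <= w)%O, (w <= z)%O & l w = n] >].
have exP : exists n, P n.
  exists (l x); apply/asboolP; exists [::].
  by rewrite word_nil mulg1; split=> //; exact: lexx.
have ubP n : P n -> (n <= l z)%N.
  by move=> /asboolP[t [_ /weak_le_length + <-]].
have [n /asboolP[t]] := ex_maxnP exP ubP.
set w := (x * word D a b t)%g => -[xw wz wn] wmax.
have Dc (e : bool) : simple D (if e then a else b) by case: e.
have down (e : bool) (c := if e then a else b) :
    in_cone2 a b (- word D a b t c).
  have rwc : roots (w c) by apply/root_act/root_simple/Dc.
  have [[p [q [p0 q0 E]]]|//] := dihedral_sign_letter Da Db ab t e.
  have wc : nonneg (w c).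
    by rewrite /w coxM E coxD !coxZ; exact: nonneg_comb.
  have zwc : inv_roots z (w c).
    apply/inv_rootsP; split=> //.
    move: zxa zxb => /inv_rootsP[_ zxa] /inv_rootsP[_ zxb].
    rewrite /w coxM E !coxD !coxZ opprD -!scalerN; exact: nonneg_comb.
  have wcz := weak_cover_le (Dc e) wz zwc.
  have : P (l (w * s_ c)%g).
    apply/asboolP; exists (rcons t e).
    rewrite -cats1 word_cat word_cons word_nil mulg1 mulgA; split=> //.
    by apply: le_trans xw _; exact: weak_cover.
  by move=> /wmax; rewrite (length_up (Dc e) wc) wn ltnn.
have inv_w (e : bool) (c := if e then a else b) : inv_roots w (x c).
  have rxc : roots (x c) by apply/root_act/root_simple/Dc.
  apply/inv_rootsP; split; first by split=> //; rewrite /c; case: (e).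
  rewrite /w invgM coxM coxK -word_rev //.
  have [[p [q [p0 q0 E]]]|[p [q [p0 q0 ->]]]] :=
    dihedral_sign_letter Da Db ab (rev t) e; last first.
    by apply: nonneg_comb => //; exact: nonneg_simple.
  case: (root_nonnegN (root_simple (Dc e)) (nonneg_simple (Dc e))).
  have -> : (if e then a else b) = word D a b t (p *: a + q *: b).
    by rewrite -E word_rev // coxKV.
  rewrite coxD !coxZ opprD -!scalerN; apply: nonneg_comb => //.
    have [p' [q' [p'0 q'0 ->]]] := down true.
    by apply: nonneg_comb => //; exact: nonneg_simple.
  have [p' [q' [p'0 q'0 ->]]] := down false.
  by apply: nonneg_comb => //; exact: nonneg_simple.
exists w; split.
- exact: weak_cover_le (inv_w true).
- exact: weak_cover_le (inv_w false).
move=> G cG aG bG v iv.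
have [xv|[p [q [p0 q0 vE]]]] := inv_word Da Db ab xa xb iv.
  by apply: aG; apply/(inv_step Da xa); left.
rewrite vE; apply: cG.2 => //; last by rewrite -vE; case/inv_rootsP: iv => -[].
  by apply: aG; apply/(inv_step Da xa); right.
by apply: bG; apply/(inv_step Db xb); right.
Qed.

(** Two elements below [z] have a join, by induction on the length of the
    interval from a common lower bound [u] to [z]: replace the pair by covers
    of [u] below them, join those, and climb. *)
Lemma join_below z (u : W) x y : (u <= x)%O -> (u <= y)%O -> (x <= z)%O ->
  (y <= z)%O -> exists j, closure_join x y j.
Proof.
have [n] := ubnP (l z - l u); elim: n u x y => // n IHn u x y un ux uy xz yz.
have [uE|/eqP uNx] := eqVneq u x.
  by exists y; split=> //; rewrite -?uE ?lexx.
have [uE|/eqP uNy] := eqVneq u y.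
  by exists x; split=> //; rewrite -?uE ?lexx.
have [a Da [ua xua uax]] := weak_lt_cover ux uNx.
have [b Db [ub yub uby]] := weak_lt_cover uy uNy.
have shorter c w : simple D c -> nonneg (u c) -> ((u * s_ c)%g <= w)%O ->
    (w <= z)%O -> (l z - l (u * s_ c)%g < n)%N.
  move=> Dc uc ucw wz; have := weak_le_length (le_trans ucw wz).
  by rewrite length_up //; lia.
have na := shorter _ _ Da ua uax xz; have nb := shorter _ _ Db ub uby yz.
have [abE|ab] := pselect (a = b).
  by apply: (IHn _ _ _ na) => //; rewrite abE.
have [j jP] : exists j, closure_join (u * s_ a)%g (u * s_ b)%g j.
  apply: (join_of_covers (z := z)) => //; last exact: le_trans xz.
    by move/weak_leP: xz; apply.
  by move/weak_leP: yz; apply.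
have jz : (j <= z)%O.
  by apply: (closure_join_le jP); [exact: le_trans xz|exact: le_trans yz].
have [aj bj jG] := jP.
have [p pP] := IHn _ _ _ na uax aj xz jz.
have [q qP] := IHn _ _ _ nb uby bj yz jz.
have pz := closure_join_le pP xz jz; have qz := closure_join_le qP yz jz.
have [xp jp pG] := pP; have [yq jq qG] := qP.
have [r [pr qr rG]] := IHn _ _ _ na (le_trans uax xp) (le_trans aj jq) pz qz.
exists r; split; [exact: le_trans pr|exact: le_trans qr|].
move=> G cG xG yG.
have jsG : inv_roots j `<=` G.
  apply: jG => //; first by move/weak_leP: uax => /subset_trans; apply.
  by move/weak_leP: uby => /subset_trans; apply.
by apply: rG => //; [exact: pG|exact: qG].
Qed.

(** A bounded set has a join, generated by the inversions of its elements: a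
    longest element among those whose inversions are so generated absorbs
    every element of the set. *)
Lemma bounded_join (X : set W) z : ubound X z -> exists y, ubound X y /\
  forall G, closed_roots D G -> (forall x, X x -> inv_roots x `<=` G) ->
    inv_roots y `<=` G.
Proof.
move=> Xz.
pose gen y := forall G, closed_roots D G ->
  (forall x, X x -> inv_roots x `<=` G) -> inv_roots y `<=` G.
have gen_le y : gen y -> (y <= z)%O.
  move=> yG; apply/weak_leP; apply: yG; first exact: inv_closed.
  by move=> x /Xz /weak_leP.
have exP : exists n, `[< exists2 y, gen y & l y = n >].
  exists 0%N; apply/asboolP; exists 1%g; last exact: cox_length1.
  by move=> G cG _ v /inv_rootsP[[rv nv]]; rewrite invg1 => /(root_nonnegN rv nv).
have ubP n : `[< exists2 y, gen y & l y = n >] -> (n <= l z)%N.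
  by move=> /asboolP[y /gen_le yz <-]; exact: weak_le_length.
have [n /asboolP[y yG yn] ymax] := ex_maxnP exP ubP.
exists y; split=> // x Xx.
have [j [yj xj jG]] :=
  join_below (weak_le1 y) (weak_le1 x) (gen_le _ yG) (Xz _ Xx).
have gj : gen j by move=> G cG XG; apply: jG => //; [exact: yG|exact: XG].
suff -> : y = j by [].
apply: weak_le_length_eq => //; rewrite yn; apply: ymax.
by apply/asboolP; exists j.
Qed.

End Join.

(** * Meets *)

Section Meet.
Variables (R : realType) (V : lmodType R) (D : root_basis V).
Local Notation W := (coxeter_group D).
Local Notation "<< u , v >>" := (Defs.form D u v) (format "<< u ,  v >>").
Local Notation l := (@cox_length R V D).
Local Notation nonneg := (nonneg D).
Local Notation roots := (@Defs.roots R V D).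
Local Notation s_ := (srefl D).
Implicit Types (x y z w c : W) (u v a b : V).

Lemma root_neg_exists v : roots v ->
  exists n, `[< exists2 w, l w = n & nonneg (- w v) >].
Proof.
move=> [w [a [Da ->]]]; exists (l (s_ a * w^-1)%g); apply/asboolP.
exists (s_ a * w^-1)%g => //.
by rewrite coxM coxK srefl_self // opprK; exact: nonneg_simple.
Qed.

(** The usual depth of a root; [0] is a default value for other vectors. *)
Definition depth v : nat :=
  if pselect (roots v) is left rv then ex_minn (root_neg_exists rv) else 0%N.

Lemma depth_le w v : nonneg (- w v) -> (depth v <= l w)%N.
Proof.
rewrite /depth; case: pselect => // rv wv; case: ex_minnP => n _; apply.
by apply/asboolP; exists w.
Qed.

Lemma depth_exists v : roots v -> exists2 w, l w = depth v & nonneg (- w v).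
Proof.
by rewrite /depth; case: pselect => // rv _; case: ex_minnP => n /asboolP.
Qed.

Lemma depth_act w v : roots v -> (depth (w v) <= l w + depth v)%N.
Proof.
move=> /depth_exists[w0 <- w0v]; rewrite addnC -(lengthV w).
apply: leq_trans (cox_lengthM _ _); apply: depth_le.
by rewrite coxM coxK.
Qed.

Lemma depth_descent v : pos_roots D v ->
  exists2 a, simple D a & (depth (s_ a v) < depth v)%N.
Proof.
move=> [rv nv]; have [w wd nwv] := depth_exists rv.
have [|a Da wa] := @right_descent _ _ D w.
  by move=> w1; apply: (root_nonnegN rv nv); rewrite w1 in nwv.
exists a => //; rewrite -wd; apply: leq_ltn_trans wa; apply: depth_le.
by rewrite coxM sreflK.
Qed.

(** Were the product non-positive, an element making [s_a v] negative would
    also make [v] negative, or be shortened by [s_a]. *)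
Lemma depth_lt_form a v : simple D a -> roots v ->
  (depth (s_ a v) < depth v)%N -> 0 < <<v, a>>.
Proof.
move=> Da rv; apply: contraTT; rewrite -leNgt -leqNgt => va.
have [w <- wv] := depth_exists (root_act (s_ a) rv).
have [wa|wa] : nonneg (w a) \/ nonneg (- w a).
  exact/root_sign/root_act/root_simple.
  have vE : v = s_ a v + (2 * <<v, a>>) *: a by rewrite sreflE // subrK.
  apply: depth_le; rewrite vE coxD coxZ opprD -scaleNr.
  by apply: nonnegD => //; apply: nonnegZ => //; lra.
rewrite (length_down Da wa) ltnW // ltnS; apply: depth_le.
by rewrite coxM.
Qed.

Lemma weak_le_len x y : (x <= y)%O -> l y = (l x + l (x^-1 * y)%g)%N.
Proof. by rewrite weak_leE => /eqP. Qed.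

Lemma length_divC x y : l (x^-1 * y)%g = l (y^-1 * x)%g.
Proof. by rewrite -lengthV invgM invgK. Qed.

Lemma lower_cover c z : (c <= z)%O -> c <> z -> exists z' a,
  [/\ simple D a, z = (z' * s_ a)%g, nonneg (z' a) & (c <= z')%O].
Proof.
move=> cz cNz; have [|a Da ca] := @right_descent _ _ D (c^-1 * z)%g.
  by move=> /mulg1_eq; rewrite invgK.
have zE := weak_le_len cz.
exists (z * s_ a)%g, a.
have {}ca : (l (c^-1 * (z * s_ a))%g < l (c^-1 * z)%g)%N by rewrite mulgA.
have le1 := cox_lengthM c (c^-1 * (z * s_ a))%g; rewrite mulVKg in le1.
have le2 := lengthMsrefl_le (z * s_ a)%g Da; rewrite mulsreflK // in le2.
have nza : nonneg ((z * s_ a)%g a).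
  by apply: ascent_nonneg => //; rewrite mulsreflK //; lia.
split=> //; first by rewrite mulsreflK.
by rewrite weak_leE eqn_leq le1 /=; lia.
Qed.

Lemma ninv_sub x y : (x <= y)%O -> ninv_roots y `<=` ninv_roots x.
Proof. by move=> /weak_leP xy v [pv yv]; split=> // /xy. Qed.

(** Along an interval [c, y] on which the depth of [v] is as small as the
    lengths permit, every step towards [c] lowers the depth by one. *)
Lemma depth_interval c w y v : roots v -> (c <= w)%O -> (w <= y)%O ->
  depth ((y^-1)%g v) = (l (c^-1 * y)%g + depth ((c^-1)%g v))%N ->
  depth ((y^-1)%g v) = (l (w^-1 * y)%g + depth ((w^-1)%g v))%N.
Proof.
move=> rv cw wy dE.
have rc := root_act (c^-1)%g rv; have rw := root_act (w^-1)%g rv.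
have := depth_act (w^-1 * c)%g rc; rewrite coxM coxKV.
have := depth_act (y^-1 * w)%g rw; rewrite coxM coxKV.
rewrite (length_divC w c) (length_divC y w).
have := weak_le_len cw; have := weak_le_len wy.
have := weak_le_len (le_trans cw wy); lia.
Qed.

Lemma ninv_nonneg x v : pos_roots D v -> ~ inv_roots x v ->
  nonneg ((x^-1)%g v).
Proof. by move=> pv xv; have /ninv_rootsP[] : ninv_roots x v by split. Qed.

(** Reflect [v] in the root [e] removed by the first step from [y] down to [c]
    that changes the inversions in the plane of [v] and [d]. Before that step
    all inversions of [y] in the plane are still present, so that [- e] is
    extreme among the roots of the plane that [y^-1] keeps positive. As [v] and
    [- d] are two of these, [d] is a positive multiple of [e] minus a multiple
    of [v]. Since the step lowers the depth of [v], the reflected root [b] is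
    [v] plus a positive multiple of [e], and has smaller depth. *)
Lemma plane_reflection c y v d : ninv_roots y v -> (c <= y)%O ->
  depth ((y^-1)%g v) = (l (c^-1 * y)%g + depth ((c^-1)%g v))%N ->
  inv_roots y d -> ~ inv_roots c d ->
  exists b p q, [/\ ninv_roots y b, (depth ((y^-1)%g b) < depth ((y^-1)%g v))%N,
    0 <= p, 0 <= q & d = p *: b - q *: v].
Proof.
move=> yv cy dE yd cd.
have [pv nyv] := (ninv_rootsP _ _).1 yv; have [rv nv] := pv.
pose plane u := exists p q, u = p *: v + q *: d.
pose P n := `[< exists2 z : W, [/\ (c <= z)%O, (z <= y)%O &
  forall u, plane u -> inv_roots y u -> inv_roots z u] & l z = n >].
have exP : exists n, P n.
  by exists (l y); apply/asboolP; exists y => //; split=> //; exact: lexx.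
have [n /asboolP[z [cz zy zplane] zn] zmin] := ex_minnP exP.
have zd : inv_roots z d.
  by apply: zplane => //; exists 0, 1; rewrite scale0r add0r scale1r.
have cNz : c <> z by move=> cz'; apply: cd; rewrite cz'.
(* the step from [z] down to [z'] loses the inversion [e] *)
have [z' [a [Da zE z'a cz']]] := lower_cover cz cNz.
set e := z' a in z'a.
have z'z : (z' <= z)%O by rewrite zE; exact: weak_cover.
have lz : l z = (l z').+1 by rewrite zE length_up.
have za : (z^-1)%g e = - a by rewrite zE invgM sreflV // coxM coxK srefl_self.
have [ye [p [q eE]]] : inv_roots y e /\ plane e.
  have [//|nP] := pselect (inv_roots y e /\ plane e).
  suff /zmin : P (l z') by rewrite -zn lz ltnn.
  apply/asboolP; exists z' => //; split=> //; first exact: le_trans zy.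
  move=> u pu yu; have := zplane _ pu yu; rewrite zE.
  by move=> /(inv_step Da z'a)[//|uE]; case: nP; rewrite /e -uE.
have z'y := le_trans z'z zy.
have dz := depth_interval rv cz zy dE.
have dz' := depth_interval rv cz' z'y dE.
set g := (z^-1)%g v in dz.
have rg : roots g by exact: root_act.
have gE : (z'^-1)%g v = s_ a g.
  by rewrite /g zE invgM sreflV // coxM sreflK.
rewrite gE in dz'.
have zyl : l (z'^-1 * y)%g = (l (z^-1 * y)%g).+1.
  have := weak_le_len zy; have := weak_le_len z'y; rewrite lz; lia.
have gl : (depth (s_ a g) < depth g)%N by lia.
have k0 := depth_lt_form Da rg gl; set k := 2 * <<g, a>>.
have kk : 0 < k by rewrite mulr_gt0.
pose b := z (s_ a g).
have bE : b = v + k *: e.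
  rewrite /b sreflE // coxB coxZ coxKV -/k; congr (_ + _).
  by rewrite zE coxM srefl_self // coxN scalerN opprK.
have rb : roots b by apply/root_act/root_act.
have nb : nonneg b by rewrite bE; apply: nonnegD => //; apply/nonnegZ/z'a/ltW.
have ns : nonneg (s_ a g).
  rewrite -gE; apply: ninv_nonneg => //.
  by move=> /((weak_leP _ _).1 z'y); exact: yv.2.
have ryb : roots ((y^-1)%g b) by exact: root_act.
have yb : ninv_roots y b.
  apply/ninv_rootsP; split=> //; have [//|nyb] := root_sign ryb.
  have /inv_rootsP[_] : inv_roots z b.
    apply: zplane; last by apply/inv_rootsP.
    exists (1 + k * p), (k * q).
    by rewrite bE {1}eE scalerDr !scalerA addrA scalerDl scale1r.
  by rewrite /b coxK => /(root_nonnegN (root_act _ rg) ns).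
have db : (depth ((y^-1)%g b) < depth ((y^-1)%g v))%N.
  have := depth_act (y^-1 * z)%g (root_act (s_ a) rg); rewrite coxM -/b.
  by rewrite length_divC; lia.
have ng : nonneg g.
  by apply: ninv_nonneg => //; move=> /((weak_leP _ _).1 zy); exact: yv.2.
have [[_ nd] nzd] := (inv_rootsP _ _).1 zd.
have aE : a = q *: (- (z^-1)%g d) - p *: g.
  apply: oppr_inj; rewrite -za eE coxD !coxZ -/g.
  by rewrite scalerN opprB opprK.
have re : roots e by apply/root_act/root_simple.
(* the signs of [p] and [q] say that [- e] is extreme in the plane *)
have q0 : 0 < q.
  rewrite ltNge; apply/negP => q0; have [p0|p0] := leP 0 p.
    apply: (root_nonnegN (root_simple Da) (nonneg_simple Da)).
    rewrite aE opprB -scaleNr; apply: nonneg_comb => //; lra.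
  apply: (root_nonnegN re z'a); rewrite eE opprD -!scaleNr.
  by apply: nonneg_comb => //; lra.
have p0 : 0 <= p.
  rewrite leNgt; apply/negP => p0.
  have [x x0 gx] : exists2 x, 0 <= x & (- p) *: g = x *: a.
    apply: (simple_extreme (k := 1) (v := q *: (- (z^-1)%g d)) Da).
    - by apply: nonnegZ => //; lra.
    - by apply: nonnegZ => //; lra.
    by rewrite scale1r [RHS]aE addrC scaleNr.
  have gxa : g = (x / - p) *: a.
    by rewrite mulrC -scalerA -gx scalerA mulVf ?scale1r // oppr_eq0 lt_eqF.
  apply: (root_nonnegN rv nv).
  have -> : v = z g by rewrite /g coxKV.
  rewrite gxa coxZ zE coxM srefl_self // coxN -/e scalerN opprK.
  by apply: nonnegZ => //; rewrite divr_ge0 //; lra.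
exists b, ((q * k)^-1), ((q * k)^-1 + p / q); split=> //.
- by rewrite invr_ge0 mulr_ge0 // ltW.
- by apply: addr_ge0; [rewrite invr_ge0 mulr_ge0 // ltW|rewrite divr_ge0 // ltW].
have -> : d = q^-1 *: e - (p / q) *: v.
  by rewrite eE scalerDr !scalerA mulVf ?gt_eqF // scale1r mulrC addrAC subrr add0r.
rewrite bE scalerDr scalerA scalerDl opprD addrA; congr (_ - _).
rewrite [_ *: v + _]addrC addrK; congr (_ *: _).
by field; rewrite !gt_eqF.
Qed.

(** The formula for meets, by induction on the depth of [y^-1 v]; the element
    [c] below is a lowest one such that the depth of [v] drops by one at each
    step from [y] down to [c]. *)
Lemma ninv_glb (X : set W) y G : (forall x, X x -> (y <= x)%O) ->
  (forall z, (forall x, X x -> (z <= x)%O) -> (z <= y)%O) ->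
  closed_roots D G -> (forall x, X x -> ninv_roots x `<=` G) ->
  ninv_roots y `<=` G.
Proof.
move=> yX ymax cG XG v.
have [n] := ubnP (depth ((y^-1)%g v)); elim: n v => // n IHn v vn yv.
have [pv nyv] := (ninv_rootsP _ _).1 yv; have [rv nv] := pv.
have [[x Xx xv]|nX] := pselect (exists2 x, X x & ninv_roots x v).
  exact: XG xv.
have Xv x : X x -> inv_roots x v.
  by move=> Xx; apply: ninv_inv => // xv; apply: nX; exists x.
pose P k := `[< exists2 c : W, (c <= y)%O /\
  depth ((y^-1)%g v) = (l (c^-1 * y)%g + depth ((c^-1)%g v))%N & l c = k >].
have exP : exists k, P k.
  exists (l y); apply/asboolP; exists y => //.
  by rewrite mulVg cox_length1; split=> //; exact: lexx.
have [k /asboolP[c [cy dE] ck] cmin] := ex_minnP exP.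
set g := (c^-1)%g v in dE.
have rg : roots g by exact: root_act.
have ng : nonneg g.
  by apply: ninv_nonneg => //; move=> /((weak_leP _ _).1 cy); exact: yv.2.
have [a Da dg] := depth_descent (conj rg ng).
have ag := depth_lt_form Da rg dg.
set d := s_ a g in dg.
have rd : roots d by exact: root_act.
set h := 2 * <<g, a>>; have h0 : 0 < h by rewrite mulr_gt0.
have gE : g = d + h *: a by rewrite /d sreflE // subrK.
have vE : v = c d + h *: c a by rewrite -coxZ -coxD -gE /g coxKV.
have csd : ((c * s_ a)^-1)%g v = d by rewrite invgM sreflV.
have dle z : (depth ((y^-1)%g v) <= l (z^-1 * y)%g + depth ((z^-1)%g v))%N.
  rewrite -length_divC.
  by have := depth_act (y^-1 * z)%g (root_act (z^-1)%g rv); rewrite coxM coxKV.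
have rca : roots (c a) by apply/root_act/root_simple.
(* if [c a] is negative, one could go down from [c] to [c s_a] *)
have [nca|nca] := root_sign rca; last first.
  have [c' c'E c'a] : exists2 c' : W, c = (c' * s_ a)%g & nonneg (c' a).
    exists (c * s_ a)%g; first by rewrite mulsreflK.
    by rewrite coxM srefl_self // coxN.
  have c'c : (c' <= c)%O by rewrite c'E; exact: weak_cover.
  have lc : l c = (l c').+1 by rewrite c'E length_up.
  have c'd : (c'^-1)%g v = d by rewrite -csd c'E mulsreflK.
  have c'y := le_trans c'c cy.
  have := weak_le_len cy; have := weak_le_len c'y; have := dle c'.
  rewrite c'd => H1 H2 H3.
  suff /cmin : P (l c') by lia.
  by apply/asboolP; exists c' => //; split=> //; rewrite c'd; lia.
(* if [c a] is an inversion of [y], then [c s_a] gives too small a depth *)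
have [yca|yca] := pos_inv_or_ninv y (conj rca nca).
  have csy := weak_cover_le Da cy yca.
  have := weak_le_len cy; have := weak_le_len csy; have := dle (c * s_ a)%g.
  by rewrite csd (length_up Da nca); lia.
have [x Xx xca] : exists2 x, X x & ninv_roots x (c a).
  have [//|nxca] := pselect (exists2 x, X x & ninv_roots x (c a)).
  suff csy : ((c * s_ a)%g <= y)%O.
    case: yca => _ []; apply: ((weak_leP _ _).1 csy).
    by apply/(inv_step Da nca); right.
  apply: ymax => x Xx; apply: weak_cover_le (le_trans cy (yX _ Xx)) _ => //.
  by apply: ninv_inv => // xca; apply: nxca; exists x.
have Gca : G (c a) := XG _ Xx _ xca.
have [_ nxca] := (ninv_rootsP _ _).1 xca.
have [_ nxv] := (inv_rootsP _ _).1 (Xv _ Xx).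
have nxcd : ~ nonneg ((x^-1)%g (c d)).
  move=> nxcd; apply: (root_nonnegN (root_act (x^-1)%g rv) _ nxv).
  rewrite vE coxD coxZ; apply: nonnegD => //.
  by apply: nonnegZ => //; exact: ltW.
have rcd : roots (c d) by exact: root_act.
have ncd : nonneg (c d).
  have [//|nNcd] := root_sign rcd; case: nxcd.
  have : inv_roots c (- c d).
    apply/inv_rootsP; split; first by split=> //; exact: rootN.
    rewrite coxN opprK coxK.
    apply: (srefl_pos Da (conj rg ng) _).2 => ga.
    have : inv_roots x (c a) by rewrite -ga /g coxKV; exact: Xv.
    by move/inv_ninvF; apply.
  move=> /((weak_leP _ _).1 (le_trans cy (yX _ Xx)))/inv_rootsP[_].
  by rewrite coxN opprK.
have [ycd|ycd] := pos_inv_or_ninv y (conj rcd ncd); last first.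
  rewrite vE -[c d]scale1r; apply: cG.2 => //; rewrite ?ler01 ?(ltW h0) //.
    apply: IHn ycd; have := depth_act (y^-1 * c)%g rd.
    by rewrite coxM length_divC; lia.
  by rewrite scale1r -vE.
have ncd' : ~ inv_roots c (c d).
  move=> /inv_rootsP[_]; rewrite coxK; apply: root_nonnegN => //.
  apply: (srefl_pos Da (conj rg ng) _).2 => ga.
  have : inv_roots x (c a) by rewrite -ga /g coxKV; exact: Xv.
  by move/inv_ninvF; apply.
have [b [p [q [yb db p0 q0 cdE]]]] := plane_reflection yv cy dE ycd ncd'.
have Gb : G b by apply: IHn => //; lia.
have q1 : 0 < 1 + q by lra.
have vE' : v = (h / (1 + q)) *: c a + (p / (1 + q)) *: b.
  have : (1 + q) *: v = h *: c a + p *: b.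
    by rewrite scalerDl scale1r {1}vE cdE addrAC subrK addrC.
  move=> /(congr1 (fun u => (1 + q)^-1 *: u)).
  by rewrite scalerA mulVf ?gt_eqF // scale1r scalerDr !scalerA ![_^-1 * _]mulrC.
rewrite vE'; apply: cG.2 => //; rewrite -?vE' //.
  by rewrite divr_ge0 // ltW.
by rewrite divr_ge0 // ltW.
Qed.

End Meet.

(** * The weak order *)

Section WeakOrder.
Variables (R : realType) (V : lmodType R) (D : root_basis V).
Local Notation W := (coxeter_group D).

Lemma root_closureP (G H : set V) : closed_roots D H ->
  G `<=` H -> (forall K, closed_roots D K -> G `<=` K -> H `<=` K) ->
  H = root_closure D G.
Proof.
move=> cH GH Hmin; apply/seteqP; split.
  by move=> v Hv K [cK GK]; exact: Hmin Hv.
by move=> v; apply.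
Qed.

Lemma bounded_supremum (X : set W) z : ubound X z -> exists y, supremums X y /\
  inv_roots y = root_closure D (\bigcup_(x in X) inv_roots x).
Proof.
move=> /bounded_join[y [yX yG]]; exists y; split.
  split=> // w wX; apply/weak_leP; apply: yG; first exact: inv_closed.
  by move=> x /wX /weak_leP.
apply: root_closureP; first exact: inv_closed.
  by move=> v [x /yX /weak_leP xy /xy].
by move=> K cK XK; apply: yG => // x Xx v xv; apply: XK; exists x.
Qed.

Lemma supremum_unique (X : set W) y z : supremums X y -> supremums X z -> y = z.
Proof.
move=> [yX ymin] [zX zmin]; apply: le_anti.
by rewrite (ymin _ zX) (zmin _ yX).
Qed.

Lemma nonempty_infimum (X : set W) : X !=set0 -> exists y, infimums X y.
Proof.
move=> [x Xx]; have [|y [[yub ymin] _]] := @bounded_supremum (lbound X) x.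
  by move=> z /(_ _ Xx).
exists y; split=> [w Xw|z zX]; last exact: yub.
by apply: ymin => z /(_ _ Xw).
Qed.

Lemma infimum_ninv (X : set W) y : infimums X y ->
  ninv_roots y = root_closure D (\bigcup_(x in X) ninv_roots x).
Proof.
move=> [yX ymax]; apply: root_closureP; first exact: ninv_closed.
  by move=> v [x /yX yx xv]; exact: ninv_sub xv.
move=> K cK XK; apply: (@ninv_glb _ _ _ X) => // x Xx v xv.
by apply: XK; exists x.
Qed.

End WeakOrder.

Theorem theorem1p5 (R : realType) (V : lmodType R) (D : root_basis V) :
  complete_meet_semilattice (coxeter_group D) /\
  forall X : set (coxeter_group D), X !=set0 ->
    [/\ (exists y, supremums X y) <-> (exists y, ubound X y),
        forall y, supremums X y ->
          inv_roots y = root_closure D (\bigcup_(x in X) inv_roots x) &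
        forall y, infimums X y ->
          ninv_roots y = root_closure D (\bigcup_(x in X) ninv_roots x)].
Proof.
split=> [X|X _]; first exact: nonempty_infimum.
split=> [|y yX|y]; last exact: infimum_ninv.
  split=> [[y [yX _]]|[z zX]]; first by exists y.
  by have [y [yP _]] := bounded_supremum zX; exists y.
have [z [zX zE]] := bounded_supremum yX.1.
by rewrite (supremum_unique yX zX).
Qed.
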